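(* Let $\mathfrak d=\sum_{i=1}^k Q_i(z)\frac{d^i}{dz^i}$ be a high-order Heun operator with $Q_i(z)=\sum_{j=0}^{i+1}q_{i,j}z^j$, and let $$\lambda(s)=\sum_{i=1}^kq_{i,i+1}\,s(s-1)\cdots(s-i+1),\qquad \lambda_n=\lambda(n).$$ There exists $n_0$ such that $\lambda(n)\neq\lambda(s)$ for all integers $0\le s<n$ and $n\ge n_0$. Consequently, for $n\ge n_0$ and any $t\in\mathbb C$, every non-zero vector in the kernel of $$\mathfrak d-\lambda_n(z-t):\mathrm{Pol}_{\le n}\longrightarrow\mathrm{Pol}_{\le n}$$ has exact degree $n$. Hence $$Sp_n(t)=\det\big(tI-Z+\lambda_n^{-1}\mathfrak d\big)$$ with no extra factors coming from polynomial solutions of lower degree, where $Z$ denotes multiplication by $z$ and $tI-Z+\lambda_n^{-1}\mathfrak d$ is regarded as an operator on $\mathrm{Pol}_{\le n}$.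
   Context: Let $k\ge1$. A high-order Heun operator (Fuchs index one) is $\mathfrak d=\sum_{i=1}^kQ_i(z)\frac{d^i}{dz^i}$ with complex polynomials $Q_i$, $\deg Q_i\le i+1$, $\deg Q_k=k+1$. $\mathrm{Pol}_{\le n}$ is the space of complex polynomials in $z$ of degree at most $n$; the operator $\mathfrak d-\lambda_n(z-t)$ preserves it because the coefficients of $z^{n+1}$ cancel (equivalently, in the monomial basis use the matrices of $Z$ and $\mathfrak d$ truncated to $\mathrm{Pol}_{\le n}$). A Van Vleck polynomial for degree $n$ is an at most linear polynomial $V$ such that $(\mathfrak d+V)S=0$ for some polynomial $S$ of degree exactly $n$. For all large $n$ every such $V$ has the form $-\lambda_n(z-z_{n,j})$; there are $n+1$ of them counted with natural algebraic multiplicity (the algebraic multiplicity of $z_{n,j}$ as an eigenvalue of $S\mapsto zS-\lambda_n^{-1}\mathfrak dS$ on $\mathrm{Pol}_{\le n}$), and $Sp_n(z)=\prod_{j=1}^{n+1}(z-z_{n,j})$ is the $n$-th spectral polynomial. *)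

(* Defs.v *)
(* The complex numbers are R[i] for R : realType; the definitions below make
   sense over any field F. *)
From HB Require Import structures.
From mathcomp Require Import all_boot all_order all_algebra.
From mathcomp Require Import boolp classical_sets cardinality fsbigop reals.
From mathcomp Require Import complex.

Set Implicit Arguments.
Unset Strict Implicit.
Unset Printing Implicit Defensive.

Import GRing.Theory.
Local Open Scope ring_scope.

(* Fuchs index one: deg (Q i) <= i + 1 and deg (Q k) = k + 1, with
   size p = deg p + 1. Only Q 1, ..., Q k matter. *)
Definition high_order_heun (F : fieldType) (k : nat) (Q : nat -> {poly F}) :=
  [/\ (0 < k)%N,
      forall i, (0 < i <= k)%N -> (size (Q i) <= i.+2)%N &
      size (Q k) = k.+2].

Definition diff_op (F : fieldType) (k : nat) (Q : nat -> {poly F})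
    (p : {poly F}) : {poly F} :=
  \sum_(1 <= i < k.+1) Q i * p^`(i).

Fact diff_op_is_linear (F : fieldType) k (Q : nat -> {poly F}) :
  linear (diff_op k Q).
Proof.
move=> a p q; rewrite /diff_op scaler_sumr -big_split /=.
by apply: eq_bigr => i _; rewrite linearP mulrDr -scalerAr.
Qed.

HB.instance Definition _ (F : fieldType) k (Q : nat -> {poly F}) :=
  GRing.isLinear.Build F {poly F} {poly F} _ (diff_op k Q)
    (diff_op_is_linear k Q).

Definition mulX (F : fieldType) (p : {poly F}) : {poly F} := 'X * p.

Fact mulX_is_linear (F : fieldType) : linear (@mulX F).
Proof. by move=> a p q; rewrite /mulX mulrDr -scalerAr. Qed.

HB.instance Definition _ (F : fieldType) :=
  GRing.isLinear.Build F {poly F} {poly F} _ (@mulX F) (@mulX_is_linear F).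

Definition lambda (F : fieldType) (k : nat) (Q : nat -> {poly F}) (s : F) : F :=
  \sum_(1 <= i < k.+1) (Q i)`_i.+1 * \prod_(0 <= j < i) (s - j%:R).

(* Pol_{<= n} is {poly_n.+1 F}. A linear operator f on polynomials is
   compressed to Pol_{<= n}: apply f, then drop the monomials of degree > n.
   Compression is linear in f, so nothing is lost on a combination of operators
   that preserves Pol_{<= n}; see heun_pencilE. *)
Definition compress (F : fieldType) (n : nat)
    (f : {linear {poly F} -> {poly F}}) : 'End({poly_n.+1 F}) :=
  linfun (npolyp n.+1 \o f \o @polyn F n.+1).

Definition mulX_le (F : fieldType) (n : nat) : 'End({poly_n.+1 F}) :=
  compress n (@mulX F).

Definition diff_op_le (F : fieldType) (k : nat) (Q : nat -> {poly F})
    (n : nat) : 'End({poly_n.+1 F}) :=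
  compress n (diff_op k Q).

Definition monomial_mx (F : fieldType) (n : nat) (f : 'End({poly_n.+1 F})) :
    'M[F]_n.+1 :=
  \matrix_(i, j) (f (tnth (npolyX F n.+1) j))`_i.

Definition det_end (F : fieldType) (n : nat) (f : 'End({poly_n.+1 F})) : F :=
  \det (monomial_mx f).

Definition alg_mult (F : fieldType) (n : nat) (f : 'End({poly_n.+1 F}))
    (t : F) : nat :=
  mup t (char_poly (monomial_mx f)).

Definition heun_pencil (F : fieldType) (k : nat) (Q : nat -> {poly F})
    (n : nat) (t : F) : 'End({poly_n.+1 F}) :=
  diff_op_le k Q n - lambda k Q n%:R *: (mulX_le F n - t *: \1%VF).

Definition van_vleck (F : fieldType) (k : nat) (Q : nat -> {poly F})
    (n : nat) (V : {poly F}) : Prop :=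
  (size V <= 2)%N /\
  exists S : {poly F}, size S = n.+1 /\ diff_op k Q S + V * S = 0.

(* All z_{n,j}, without multiplicity. For large n every Van Vleck polynomial
   has the form -lambda_n (z - z_{n,j}). *)
Definition van_vleck_roots (F : fieldType) (k : nat) (Q : nat -> {poly F})
    (n : nat) : set F :=
  [set t | van_vleck k Q n (- (lambda k Q n%:R *: ('X - t%:P)))]%classic.

(* The product ranges over the distinct Van Vleck roots, each one repeated
   according to its algebraic multiplicity as an eigenvalue of
   S |-> z S - lambda_n^-1 d S. It is finitely supported: the exponent vanishes
   at any t that is not an eigenvalue. *)
Definition spectral_poly (F : fieldType) (k : nat) (Q : nat -> {poly F})
    (n : nat) : {poly F} :=
  \big[*%R/1]_(t \in van_vleck_roots k Q n)
    ('X - t%:P) ^+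
      alg_mult (mulX_le F n - (lambda k Q n%:R)^-1 *: diff_op_le k Q n) t.

Fact compress_fun_linear (F : fieldType) n
    (f : {linear {poly F} -> {poly F}}) :
  linear (npolyp n.+1 \o f \o @polyn F n.+1).
Proof.
move=> a u v; apply/npolyP => i /=.
have -> : f (a *: u + v) = a *: f u + f v by rewrite -linearP.
rewrite [RHS]coefD coefZ !coef_npolyp coefD coefZ.
by case: ifP => // _; rewrite mulr0 addr0.
Qed.

Lemma compressE (F : fieldType) n (f : {linear {poly F} -> {poly F}})
    (p : {poly_n.+1 F}) :
  compress n f p = npolyp n.+1 (f p).
Proof.
pose g : {linear {poly_n.+1 F} -> {poly_n.+1 F}} :=
  HB.pack (npolyp n.+1 \o f \o @polyn F n.+1)
    (GRing.isLinear.Build F _ _ _ _ (compress_fun_linear f)).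
exact: (lfunE g p).
Qed.

Lemma ffact_prod (F : fieldType) (n i : nat) :
  \prod_(0 <= j < i) (n%:R - j%:R) = (n ^_ i)%:R :> F.
Proof.
elim: i => [|i IHi]; first by rewrite big_nil ffactn0.
rewrite big_nat_recr //= IHi ffactnSr natrM.
have [lein|ltni] := leqP i n; first by rewrite natrB.
by rewrite ffact_small // !mul0r.
Qed.

Lemma coef_diff_op_gt (F : fieldType) k (Q : nat -> {poly F}) n m
    (S : {poly_n.+1 F}) :
  high_order_heun k Q -> (n <= m)%N ->
  (diff_op k Q S)`_m.+1 = lambda k Q n%:R * S`_m.
Proof.
move=> [_ szQ _] lenm; rewrite coef_sum mulr_suml.
rewrite big_seq [RHS]big_seq; apply: eq_bigr => i.
rewrite mem_index_iota ltnS => /szQ szQi; rewrite ffact_prod -mulrA coefM.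
have term0 (j : 'I_m.+2) : j != i.+1 :> nat ->
    (Q i)`_j * (S^`(i))`_(m.+1 - j) = 0.
  rewrite neq_ltn ltnS => /orP[leji|ltij]; last first.
    by rewrite nth_default ?mul0r // (leq_trans szQi).
  rewrite coef_derivn [S`__]nth_default ?mul0rn ?mulr0 //.
  rewrite (leq_trans (size_npoly S)) //.
  rewrite addnBA -1?ltnS ?ltn_ord // [(i + _)%N]addnC -addnBA // addSn ltnS.
  exact: leq_trans lenm (leq_addr _ _).
have [leim|ltmi] := leqP i m; last first.
  rewrite ffact_small ?(leq_ltn_trans lenm) // mul0r mulr0 big1 // => j _.
  by apply: term0; rewrite neq_ltn (leq_trans (ltn_ord j)).
have lti : (i.+1 < m.+2)%N by rewrite !ltnS.
rewrite (bigD1 (Ordinal lti)) //= big1 ?addr0 => [|j neq]; last first.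
  exact: term0.
rewrite subSS coef_derivn subnKC // -[S`_m *+ _]mulr_natl.
have [ltnm|lemn] := ltnP n m.
  by rewrite [S`_m]nth_default ?(leq_trans (size_npoly S)) // !mulr0.
by have /eqP <- : n == m by rewrite eqn_leq lenm.
Qed.

Lemma heun_pencilE (F : fieldType) k (Q : nat -> {poly F}) n t
    (S : {poly_n.+1 F}) :
  high_order_heun k Q ->
  heun_pencil k Q n t S =
    diff_op k Q S - lambda k Q n%:R *: (('X - t%:P) * S) :> {poly F}.
Proof.
move=> heun.
have -> : heun_pencil k Q n t S = npolyp n.+1 (diff_op k Q S)
    - lambda k Q n%:R *: (npolyp n.+1 ('X * polyn S) - t *: S).
  rewrite /heun_pencil add_lfunE opp_lfunE scale_lfunE add_lfunE opp_lfunE.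
  by rewrite scale_lfunE id_lfunE !compressE.
rewrite [LHS](_ : _ = polyn (npolyp n.+1 (diff_op k Q S))
    - lambda k Q n%:R *: (polyn (npolyp n.+1 ('X * polyn S)) - t *: polyn S)) //.
apply/polyP => m; rewrite mulrBl mul_polyC !(coefB, coefZ) !coef_npolyp.
case: ltnP => // ltnm; case: m ltnm => // m; rewrite ltnS => lenm.
rewrite (coef_diff_op_gt _ heun lenm) coefXM /= [S`_m.+1]nth_default.
  by rewrite mulr0 !subr0 mulr0 !subrr.
by rewrite (leq_trans (size_npoly S)).
Qed.

(* Main.v *)
(* The real part of lambda(s) / q_{k,k+1} at natural numbers s is a real
   polynomial in s, monic of degree k >= 1, hence eventually increasing and
   eventually larger than any of its finitely many earlier values: this gives
   n0. The coefficient of z^(m+1) in the equation for a kernel vector of degree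
   m reads lambda_m = lambda_n when m < n, so every kernel vector has degree n.
   Every eigenvalue of Z - lambda_n^-1 d is thus a Van Vleck root, and Sp_n is
   the whole characteristic polynomial. *)
Require Import Defs.
From mathcomp Require Import all_boot all_order all_algebra.
From mathcomp Require Import classical_sets fsbigop.
From mathcomp Require Import reals complex polyrcf polyorder.

Set Implicit Arguments.
Unset Strict Implicit.
Unset Printing Implicit Defensive.

Import Order.TTheory GRing.Theory Num.Theory.
Local Open Scope ring_scope.

(** From some point [x1] on the derivative is positive, which settles the large [s]; the finitely
    many [s] below [n1] are beaten because [p] tends to infinity. *)
Lemma horner_natr_eventually_gt (R : realType) (p : {poly R}) :
  0 < lead_coef p -> (1 < size p)%N ->
  exists n0 : nat, forall n s : nat,
    (n0 <= n)%N -> (s < n)%N -> p.[s%:R] < p.[n%:R].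
Proof.
move=> lc_gt0 sz_gt1.
have dp_lc_gt0 : 0 < lead_coef p^`().
  move: lc_gt0; rewrite !lead_coefE coef_deriv size_deriv.
  by case: (size p) sz_gt1 => [|[|m]] // _; rewrite pmulrn_lgt0.
have [x1 dp_gt0] := poly_pinfty_gt_lc dp_lc_gt0.
pose n1 := Num.bound `|x1|.
(* The threshold exceeds every [p.[i%:R]] with [i < n1]; the summand 1 makes the inequality
   strict. *)
have [x2 p_large] :=
  poly_lim_infty (1 + \sum_(i < n1) `|p.[i%:R]|) lc_gt0 sz_gt1.
exists (Num.bound `|x2|) => n s len lts.
have [les|ltsn1] := leqP n1 s.
  have lt_sn : s%:R < n%:R :> R by rewrite ltr_nat.
  (* The intermediate point [c] lies beyond [s], hence beyond [x1], where the derivative is at least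
     its positive leading coefficient. *)
  have [c /andP[/= ltsc _] mvt] := poly_mvt p lt_sn.
  rewrite -subr_gt0 mvt mulr_gt0 ?subr_gt0 //.
  apply: lt_le_trans dp_lc_gt0 _; apply: dp_gt0.
  rewrite (le_trans (ler_norm _)) // ltW // (lt_trans (archi_boundP _)) //.
  by apply: le_lt_trans ltsc; rewrite ler_nat.
apply: (@lt_le_trans _ _ (1 + \sum_(i < n1) `|p.[i%:R]|)).
  rewrite (bigD1 (Ordinal ltsn1)) //= addrCA.
  rewrite (le_lt_trans (ler_norm _)) // ltrDl ltr_wpDr ?ltr01 //.
  by rewrite sumr_ge0.
apply: p_large; rewrite (le_trans (ler_norm _)) // ltW //.
by rewrite (lt_le_trans (archi_boundP _)) // ler_nat.
Qed.

Section RealPart.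

Variables (R : realType) (k : nat) (Q : nat -> {poly R[i]}).

Definition re_lambda : {poly R} :=
  \sum_(1 <= i < k.+1)
     complex.Re ((Q i)`_i.+1 / (Q k)`_k.+1) *:
       \prod_(0 <= j < i) ('X - j%:R%:P).

(** At a natural number each falling factorial is a natural number, and the additive map [Re]
    commutes with natural multiples. *)
Lemma horner_re_lambda (s : nat) :
  re_lambda.[s%:R] = complex.Re (lambda k Q s%:R / (Q k)`_k.+1).
Proof.
rewrite /re_lambda /lambda mulr_suml.
rewrite (raddf_sum (@complex.Re R : Rcomplex R -> R)).
rewrite horner_sum; apply: eq_bigr => i _.
rewrite hornerZ horner_prod Defs.ffact_prod mulrAC mulr_natr.
rewrite (raddfMn (@complex.Re R : Rcomplex R -> R)).
under eq_bigr => j _ do rewrite !hornerE.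
by rewrite Defs.ffact_prod mulr_natr.
Qed.

Lemma re_lambda_size_monic (heun : high_order_heun k Q) :
  size re_lambda = k.+1 /\ lead_coef re_lambda = 1.
Proof.
case: heun => k_gt0 _ szQk.
have c_neq0 : (Q k)`_k.+1 != 0.
  rewrite -[k.+1]/(k.+2.-1) -szQk -lead_coefE lead_coef_eq0.
  by rewrite -size_poly_eq0 szQk.
(* The summand [i = k] has coefficient 1 and is a monic falling factorial of degree [k]; all others
   have smaller degree. *)
rewrite /re_lambda big_nat_recr //= divff //= scale1r.
set q := \prod_(0 <= _ < k) _; set r := \sum_(1 <= _ < k) _.
have szq : size q = k.+1 by rewrite size_prod_XsubC size_iota subn0.
have lt_rq : (size r < size q)%N.
  rewrite szq ltnS (leq_trans (size_sum _ _ _)) //.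
  rewrite big_seq; apply/bigmax_leqP_seq => i.
  rewrite mem_index_iota => /andP[_ ltik] _.
  rewrite (leq_trans (size_scale_leq _ _)) //.
  by rewrite size_prod_XsubC size_iota subn0.
rewrite addrC size_polyDl // lead_coefDl // szq; split=> //.
exact/monicP/monic_prod_XsubC.
Qed.

Lemma lambda_eventually_neq (heun : high_order_heun k Q) :
  exists n0 : nat, forall n s : nat, (n0 <= n)%N -> (s < n)%N ->
    lambda k Q n%:R <> lambda k Q s%:R.
Proof.
have [sz lc] := re_lambda_size_monic heun; case: heun => k_gt0 _ _.
have [||n0 gt_n0] := @horner_natr_eventually_gt R re_lambda.
- by rewrite lc ltr01.
- by rewrite sz ltnS.
exists n0 => n s len lts eq_ns; have := gt_n0 n s len lts.
by rewrite !horner_re_lambda eq_ns ltxx.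
Qed.

End RealPart.

Section Endomorphisms.

Variables (F : fieldType) (n : nat).
Implicit Types (f : 'End({poly_n.+1 F})) (t : F).

Lemma det_end_eq0 f : det_end f = 0 -> exists2 S, S \in lker f & S <> 0.
Proof.
(* [det0P] gives a row vector killed from the left, while images of monomials are columns; hence the
   transpose. *)
rewrite /det_end -det_tr => /eqP/det0P[v v_neq0 vf0].
exists (\sum_j v 0 j *: tnth (npolyX F n.+1) j).
  rewrite memv_ker linear_sum; apply/eqP/npolyP => m; rewrite coef0.
  have [ltm|lem] := ltnP m n.+1; last exact: big_coef_npoly.
  have /rowP/(_ (Ordinal ltm)) := vf0; rewrite !mxE => vf0m.
  rewrite coefn_sum -[RHS]vf0m.
  by apply: eq_bigr => j _; rewrite !mxE linearZ coefZ.
move=> S0; case/eqP: v_neq0; apply/rowP => i; rewrite mxE.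
have /(congr1 (fun p : {poly_n.+1 F} => p`_i)) := S0.
rewrite coef0 coefn_sum (bigD1 i) //= coefZ npolyXE coefXn eqxx mulr1.
rewrite big1 ?addr0 // => j neq_ji.
by rewrite coefZ npolyXE coefXn eq_sym (inj_eq val_inj) (negPf neq_ji) mulr0.
Qed.

Lemma det_end_subr t f :
  det_end (t *: \1%VF - f) = (char_poly (monomial_mx f)).[t].
Proof.
rewrite /det_end /char_poly -[RHS]/(horner_eval t _) -det_map_mx.
congr (\det _).
apply/matrixP => i j; rewrite !mxE [RHS]/= /horner_eval !hornerE.
rewrite add_lfunE opp_lfunE scale_lfunE id_lfunE coefB coefZ.
rewrite [\val (tnth _ _)]npolyXE coefXn.
by rewrite hornerMn hornerX mulr_natr.
Qed.

End Endomorphisms.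

Section Spectral.

Variables (F : fieldType) (k : nat) (Q : nat -> {poly F}) (n : nat).
Hypothesis heun : high_order_heun k Q.
Hypothesis lambda_inj :
  forall s : nat, (s < n)%N -> lambda k Q n%:R <> lambda k Q s%:R.

Lemma size_lker_heun_pencil (t : F) (S : {poly_n.+1 F}) :
  S \in lker (heun_pencil k Q n t) -> S <> 0 -> size S = n.+1.
Proof.
rewrite memv_ker => /eqP HS S_neq0; have := heun_pencilE t S heun.
(* The index [size S] is one more than the degree of [S]. *)
rewrite HS => /(congr1 (fun p : {poly F} => p`_(size S))).
have szS_gt0 : (0 < size S)%N.
  by rewrite size_poly_gt0; apply/eqP => S0; apply: S_neq0; apply: val_inj.
have := size_npoly S; rewrite leq_eqVlt => /orP[/eqP //|].
case DS: (size S) szS_gt0 => [//|m] _; rewrite ltnS => ltmn.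
have leS : (size S <= m.+1)%N by rewrite DS.
rewrite coef0 coefB coefZ mulrBl mul_polyC coefB coefXM coefZ /=.
rewrite [S`_m.+1]nth_default // mulr0 subr0 => eq0.
(* Viewed in polynomials of degree at most [m], [S] yields the coefficient [lambda] at [m] times
   [S_m] in [coef_diff_op_gt]. *)
have Sm : S = npolyp m.+1 S :> {poly F} by rewrite npolypK.
move: eq0; rewrite {1}Sm (coef_diff_op_gt _ heun) // coef_npolyp ltnSn -mulrBl.
move/esym/eqP; rewrite mulf_eq0 subr_eq0 => /orP[/eqP/esym/lambda_inj|] //.
rewrite -[m]/(m.+1.-1) -DS -lead_coefE lead_coef_eq0.
by rewrite -size_poly_eq0 DS.
Qed.

Hypothesis n_gt0 : (0 < n)%N.

Lemma lambda_neq0 : lambda k Q n%:R != 0.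
Proof.
(* Every product in [lambda] contains the factor [s - 0], so the value at 0 vanishes and differs
   from the value at [n]. *)
suff <- : lambda k Q 0 = 0 by apply/eqP; exact: (lambda_inj n_gt0).
rewrite /lambda big_nat_cond big1 // => i /andP[/andP[i_gt0 _] _].
by rewrite big_ltn // subrr mul0r mulr0.
Qed.

Let eigen_op : 'End({poly_n.+1 F}) :=
  mulX_le F n - (lambda k Q n%:R)^-1 *: diff_op_le k Q n.

Lemma heun_pencil_scale (t : F) :
  heun_pencil k Q n t = lambda k Q n%:R *: (t *: \1%VF - eigen_op).
Proof.
rewrite /heun_pencil /eigen_op opprB addrCA [RHS]scalerDr scalerA.
by rewrite (divff lambda_neq0) scale1r -[t *: _ - _]opprB scalerN.
Qed.

Lemma root_char_poly_van_vleck (t : F) :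
  root (char_poly (monomial_mx eigen_op)) t -> van_vleck_roots k Q n t.
Proof.
move/rootP; rewrite -det_end_subr => /det_end_eq0[S].
rewrite memv_ker => /eqP HS S_neq0.
have pencil0 : heun_pencil k Q n t S = 0.
  by rewrite heun_pencil_scale scale_lfunE HS scaler0.
split.
  by rewrite size_polyN (leq_trans (size_scale_leq _ _)) // size_XsubC.
exists S; split.
  by apply: (@size_lker_heun_pencil t) => //; rewrite memv_ker pencil0.
by rewrite mulNr -scalerAl -(heun_pencilE _ _ heun) pencil0.
Qed.

End Spectral.

Lemma spectral_polyE (F : closedFieldType) (k : nat) (Q : nat -> {poly F})
    (n : nat) :
  high_order_heun k Q ->
  (forall s : nat, (s < n)%N -> lambda k Q n%:R <> lambda k Q s%:R) ->
  (0 < n)%N ->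
  spectral_poly k Q n =
    char_poly (monomial_mx
      (mulX_le F n - (lambda k Q n%:R)^-1 *: diff_op_le k Q n)).
Proof.
move=> heun lambda_inj n_gt0; rewrite /spectral_poly /alg_mult.
have vvP := @root_char_poly_van_vleck F k Q n heun lambda_inj n_gt0.
set P := char_poly _ in vvP *.
have [r] := closed_field_poly_normal P.
rewrite (monicP (char_poly_monic _)) scale1r => DP.
have rootPr t : root P t = (t \in r) by rewrite DP root_prod_XsubC.
(* The product may be cut down to the roots of [P]: all of them are Van Vleck roots, and elsewhere
   the exponent is 0. *)
rewrite -(@fsbig_widen _ _ _ _ [set` undup r]%classic).
- rewrite -fsbig_seq ?undup_uniq // [RHS]DP -[RHS]prodr_undup_exp_count.
  by apply: eq_bigr => t _; rewrite DP mu_prod_XsubC.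
- by move=> t /=; rewrite mem_undup -rootPr => /vvP.
- by move=> t [_ /= /negP]; rewrite mem_undup -rootPr => /mupNroot ->.
Qed.

Theorem lemma1 (R : realType) (k : nat) (Q : nat -> {poly R[i]})
    (heun : high_order_heun k Q) :
  exists n0 : nat,
    (forall n s : nat, (n0 <= n)%N -> (s < n)%N ->
       lambda k Q n%:R <> lambda k Q s%:R) /\
    (forall n : nat, (n0 <= n)%N -> forall (t : R[i]) (S : {poly_n.+1 R[i]}),
       S \in lker (heun_pencil k Q n t) -> S <> 0 -> size S = n.+1) /\
    (forall n : nat, (n0 <= n)%N -> forall t : R[i],
       (spectral_poly k Q n).[t] =
         det_end (t *: \1%VF - mulX_le _ n
                  + (lambda k Q n%:R)^-1 *: diff_op_le k Q n)).
Proof.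
have [n1 lambda_inj] := lambda_eventually_neq heun.
(* The 1 ensures [n > 0], from which [lambda] at [n] is invertible. *)
exists (maxn 1 n1); split; [|split] => n.
- by move=> s; rewrite geq_max => /andP[_ /lambda_inj]; apply.
- rewrite geq_max => /andP[_ len] t S.
  by apply: size_lker_heun_pencil => // s; apply: lambda_inj.
- rewrite geq_max => /andP[n_gt0 len] t.
  rewrite spectral_polyE // => [|s]; last exact: lambda_inj.
  by rewrite -det_end_subr opprB addrA addrAC.
Qed.
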